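(* Let $n\ge 1$, let $G=\mathrm{GL}(n,\mathbb{R})$ be equipped with the left invariant Riemannian metric determined by the Frobenius inner product $\langle X,Y\rangle=\mathrm{tr}(X^\top Y)$ on its Lie algebra $\mathfrak{g}=\mathfrak{gl}(n,\mathbb{R})$, and let $R$ be its curvature tensor. Let $u,v\in\mathfrak{g}$, and write $u_1=(u+u^\top)/2$, $u_2=(u-u^\top)/2$, $v_1=(v+v^\top)/2$, $v_2=(v-v^\top)/2$. Then $$\langle R(u,v)v,u\rangle=-2\|[u_1,v_1]\|^2+\frac14\|[u,v]\|^2+2\langle[u_1,v_1],[u_2,v_2]\rangle.$$
   Context: The Lie algebra $\mathfrak{g}=\mathfrak{gl}(n,\mathbb{R})$ is identified with the space of $n\times n$ real matrices, with bracket $[u,v]=uv-vu$; $\|u\|=\langle u,u\rangle^{1/2}$ is the Frobenius norm. An element $u\in\mathfrak{g}$ is also identified with the left invariant vector field on $G$ whose value at the identity $e$ is $u$ (its value at $g\in G$ is $gu$). A left invariant metric is one for which all left translations are isometries; it is determined by its inner product at $e$. $\nabla$ is the Levi-Civita connection; for left invariant fields it is given by $\langle\nabla_uv,w\rangle=\frac12(\langle[u,v],w\rangle-\langle[v,w],u\rangle-\langle[u,w],v\rangle)$, equivalently $\nabla_uv=\frac12([u,v]+[u,v^\top]+[v,u^\top])$. The curvature tensor is $R(u,v)w=\nabla_u(\nabla_vw)-\nabla_v(\nabla_uw)-\nabla_{[u,v]}w$ for $u,v,w\in\mathfrak{g}$. *)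

(* Defs.v *)
From HB Require Import structures.
From mathcomp Require Import all_boot all_order all_algebra.
From mathcomp Require Import all_classical all_reals all_analysis.

Set Implicit Arguments.
Unset Strict Implicit.
Unset Printing Implicit Defensive.

Import Order.TTheory GRing.Theory Num.Theory.
Import numFieldNormedType.Exports.

Local Open Scope classical_set_scope.
Local Open Scope ring_scope.

Section SmoothMaps.
Context {R : realType} {V W : normedModType R}.

(* For an open set [U] of a finite-dimensional space [V], where it is used
   below, [Ck U k f] says that [f] is of class C^k on [U].  Everything here is
   about restrictions to [U]: the values of [f] outside [U] are irrelevant. *)
Fixpoint Ck (U : set V) (k : nat) (f : V -> W) : Prop :=
  if k is k'.+1 then
    (forall p, U p -> differentiable f p) /\
    (forall v : V, Ck U k' (fun p => 'D_v f p))
  else forall p, U p -> {for p, continuous f}.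

Definition smooth (U : set V) (f : V -> W) : Prop := forall k, Ck U k f.

End SmoothMaps.

(* Riemannian geometry of an open subset [U] of a normed space [V], which is a
   manifold whose tangent space at every point is [V].  A vector field on [U]
   is a map [V -> V] that only matters on [U]; a metric is a family of bilinear
   forms [g p], for [p] in [U]. *)
Section OpenSubmanifold.
Context {R : realType} {V : normedModType R}.
Implicit Types (U : set V) (X Y Z : V -> V) (f : V -> R).
Implicit Types (nabla : (V -> V) -> (V -> V) -> V -> V) (g : V -> V -> V -> R).

Definition field_deriv X f : V -> R := fun p => 'D_(X p) f p.

Definition field_bracket X Y : V -> V :=
  fun p => 'D_(X p) Y p - 'D_(Y p) X p.

Record affine_connection U nabla : Prop := AffineConnection {
  conn_local : forall X X' Y Y',
    smooth U X -> smooth U X' -> smooth U Y -> smooth U Y' ->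
    {in U, X =1 X'} -> {in U, Y =1 Y'} ->
    {in U, nabla X Y =1 nabla X' Y'} ;
  conn_smooth : forall X Y,
    smooth U X -> smooth U Y -> smooth U (nabla X Y) ;
  conn_addl : forall X X' Y,
    smooth U X -> smooth U X' -> smooth U Y ->
    {in U, forall p, nabla (X \+ X') Y p = nabla X Y p + nabla X' Y p} ;
  conn_scalel : forall f X Y,
    smooth U f -> smooth U X -> smooth U Y ->
    {in U, forall p, nabla (fun q => f q *: X q) Y p = f p *: nabla X Y p} ;
  conn_addr : forall X Y Y',
    smooth U X -> smooth U Y -> smooth U Y' ->
    {in U, forall p, nabla X (Y \+ Y') p = nabla X Y p + nabla X Y' p} ;
  conn_leibniz : forall f X Y,
    smooth U f -> smooth U X -> smooth U Y ->
    {in U, forall p, nabla X (fun q => f q *: Y q) p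
                     = field_deriv X f p *: Y p + f p *: nabla X Y p}
}.

Definition torsion_free U nabla : Prop :=
  forall X Y, smooth U X -> smooth U Y ->
    {in U, forall p, nabla X Y p - nabla Y X p = field_bracket X Y p}.

Definition metric_compatible U g nabla : Prop :=
  forall X Y Z, smooth U X -> smooth U Y -> smooth U Z ->
    {in U, forall p, field_deriv Z (fun q => g q (X q) (Y q)) p
                     = g p (nabla Z X p) (Y p) + g p (X p) (nabla Z Y p)}.

Definition levi_civita U g nabla : Prop :=
  [/\ affine_connection U nabla, torsion_free U nabla
    & metric_compatible U g nabla].

Definition curvature nabla X Y Z : V -> V :=
  fun p => nabla X (nabla Y Z) p - nabla Y (nabla X Z) p
           - nabla (field_bracket X Y) Z p.

End OpenSubmanifold.

Section GeneralLinearGroup.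
Context {R : realType} {n : nat}.
Implicit Types (u v X Y p : 'M[R]_n).

Definition GL : set 'M[R]_n := [set p | p \in unitmx].

Definition lie_bracket u v : 'M[R]_n := u *m v - v *m u.

Definition frob_inner u v : R := \tr (u^T *m v).

Definition frob_norm u : R := Num.sqrt (frob_inner u u).

(* The left translation by [p^-1] is the restriction of a linear map, so its
   differential maps a tangent vector [X] at [p] to [p^-1 X] at the identity. *)
Definition left_metric p X Y : R :=
  frob_inner (invmx p *m X) (invmx p *m Y).

Lemma left_metric1 X Y : left_metric 1%:M X Y = frob_inner X Y.
Proof. by rewrite /left_metric invmx1 !mul1mx. Qed.

Lemma left_metric_invariant (h p X Y : 'M[R]_n) : GL h -> GL p ->
  left_metric (h *m p) (h *m X) (h *m Y) = left_metric p X Y.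
Proof.
move=> /= hU pU; have hpU : h *m p \in unitmx by rewrite unitmx_mul hU.
have E (Z : 'M[R]_n) : invmx (h *m p) *m (h *m Z) = invmx p *m Z.
  apply: (can_inj (mulKmx hpU)); rewrite mulKVmx //.
  by rewrite -mulmxA mulKVmx.
by rewrite /left_metric !E.
Qed.

Definition left_field u : 'M[R]_n -> 'M[R]_n := fun p => p *m u.

Definition sym_part u : 'M[R]_n := 2^-1 *: (u + u^T).

Definition skew_part u : 'M[R]_n := 2^-1 *: (u - u^T).

End GeneralLinearGroup.

Arguments GL : clear implicits.

(* Main.v *)
Require Import Defs.
From HB Require Import structures.
From mathcomp Require Import all_boot all_order all_algebra.
From mathcomp Require Import all_classical all_reals all_analysis.
From mathcomp Require Import ring lra.

Set Implicit Arguments.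
Unset Strict Implicit.
Unset Printing Implicit Defensive.

Import Order.TTheory GRing.Theory Num.Theory.
Import numFieldNormedType.Exports.

Local Open Scope classical_set_scope.
Local Open Scope ring_scope.

(** Left invariant fields [p |-> p u] have constant inner products on the open
    set GL, so the Koszul formula determines the Levi-Civita connection on them:
    nabla_u v = ([u, v] + [u, v^T] + [v, u^T]) / 2, and each nabla_u is
    skew-adjoint.  Hence <R(u,v)v, u> = - <nabla_v v, nabla_u u>
    + <nabla_u v, nabla_v u> - <nabla_[u,v] v, u>.  Split u = S + A and
    v = T + B into symmetric and skew parts and expand in the skew matrices
    [S, T], [A, B] and the symmetric matrices [A, T], [B, S]: skew is orthogonal
    to symmetric, and the Jacobi identity in the form
    <[A, T], [B, S]> = <[S, T], [A, B]> + <[A, S], [B, T]> removes the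
    remaining cross terms. *)

(** * Algebra of the Frobenius inner product and the commutator *)

Section FrobeniusInner.
Context {R : realType} {n : nat}.
Implicit Types u v w x y a s : 'M[R]_n.

Lemma frob_innerC u v : frob_inner u v = frob_inner v u.
Proof. by rewrite /frob_inner -mxtrace_tr trmx_mul trmxK. Qed.

Lemma frob_innerDl u v w :
  frob_inner (u + v) w = frob_inner u w + frob_inner v w.
Proof. by rewrite /frob_inner linearD mulmxDl linearD. Qed.

Lemma frob_innerDr u v w :
  frob_inner u (v + w) = frob_inner u v + frob_inner u w.
Proof. by rewrite /frob_inner mulmxDr linearD. Qed.

Lemma frob_innerZl (k : R) u v : frob_inner (k *: u) v = k * frob_inner u v.
Proof. by rewrite /frob_inner linearZ -scalemxAl linearZ. Qed.

Lemma frob_innerZr (k : R) u v : frob_inner u (k *: v) = k * frob_inner u v.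
Proof. by rewrite frob_innerC frob_innerZl frob_innerC. Qed.

Lemma frob_innerNl u v : frob_inner (- u) v = - frob_inner u v.
Proof. by rewrite -scaleN1r frob_innerZl mulN1r. Qed.

Lemma frob_innerNr u v : frob_inner u (- v) = - frob_inner u v.
Proof. by rewrite -scaleN1r frob_innerZr mulN1r. Qed.

Definition frob_innerE := (frob_innerDl, frob_innerDr, frob_innerZl,
  frob_innerZr, frob_innerNl, frob_innerNr).

Lemma frob_inner_ge0 u : 0 <= frob_inner u u.
Proof.
rewrite /frob_inner /mxtrace; apply: sumr_ge0 => i _; rewrite mxE.
by apply: sumr_ge0 => j _; rewrite mxE -expr2 sqr_ge0.
Qed.

Lemma frob_norm_sqr u : frob_norm u ^+ 2 = frob_inner u u.
Proof. by rewrite sqr_sqrtr // frob_inner_ge0. Qed.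

(** Pairing with [delta_mx i j] reads off the entry at [(i, j)]. *)
Lemma frob_inner_inj u v :
  (forall w, frob_inner u w = frob_inner v w) -> u = v.
Proof.
move=> uv; apply/matrixP => i j.
have := uv (delta_mx i j); rewrite /frob_inner => H.
have E w : \tr (w^T *m delta_mx i j) = w i j.
  rewrite mxtrace_mulC /mxtrace (bigD1 i) //= big1 => [|k ki].
    rewrite addr0 mxE (bigD1 j) //= big1 => [|k kj].
      by rewrite addr0 !mxE !eqxx mul1r.
    by rewrite !mxE (negPf kj) andbF mul0r.
  by rewrite mxE big1 // => l _; rewrite !mxE (negPf ki) mul0r.
by rewrite !E in H.
Qed.

Lemma lie_bracketDl u v w :
  lie_bracket (u + v) w = lie_bracket u w + lie_bracket v w.
Proof. by rewrite /lie_bracket mulmxDl mulmxDr opprD addrACA. Qed.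

Lemma lie_bracketC u v : lie_bracket u v = - lie_bracket v u.
Proof. by rewrite opprB. Qed.

Lemma lie_bracketDr u v w :
  lie_bracket u (v + w) = lie_bracket u v + lie_bracket u w.
Proof. by rewrite /lie_bracket mulmxDl mulmxDr opprD addrACA. Qed.

Lemma lie_bracketNl u v : lie_bracket (- u) v = - lie_bracket u v.
Proof. by rewrite /lie_bracket mulNmx mulmxN opprB opprK addrC. Qed.

Lemma lie_bracketNr u v : lie_bracket u (- v) = - lie_bracket u v.
Proof. by rewrite ![lie_bracket u _]lie_bracketC lie_bracketNl. Qed.

Lemma lie_bracketxx u : lie_bracket u u = 0.
Proof. exact: subrr. Qed.

Lemma lie_bracket_tr u v : (lie_bracket u v)^T = lie_bracket v^T u^T.
Proof. by rewrite /lie_bracket linearB /= !trmx_mul. Qed.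

Lemma lie_bracket_jacobi u v w : lie_bracket u (lie_bracket v w) =
  lie_bracket (lie_bracket u v) w + lie_bracket v (lie_bracket u w).
Proof.
rewrite /lie_bracket !(mulmxBl, mulmxBr) !mulmxA.
move: (u *m v *m w) (u *m w *m v) (v *m w *m u) => uvw uwv vwu.
move: (v *m u *m w) (w *m u *m v) (w *m v *m u) => vuw wuv wvu.
by apply/matrixP => i j; rewrite !mxE; ring.
Qed.

(** By cyclicity of the trace, the adjoint of ad u is ad u^T. *)
Lemma frob_inner_bracket u v w :
  frob_inner (lie_bracket u v) w = frob_inner v (lie_bracket u^T w).
Proof.
rewrite /frob_inner lie_bracket_tr /lie_bracket mulmxBl mulmxBr !linearB /=.
by rewrite -[u^T *m v^T *m w]mulmxA [in X in _ - X]mxtrace_mulC !mulmxA.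
Qed.

(** Transposing under the trace shows that the product equals its own opposite. *)
Lemma frob_inner_sym_skew s a : s^T = s -> a^T = - a -> frob_inner s a = 0.
Proof.
move=> sT aT; have : frob_inner s a = - frob_inner s a.
  rewrite {1}/frob_inner -mxtrace_tr trmx_mul trmxK aT mulNmx linearN /=.
  by rewrite mxtrace_mulC /frob_inner sT.
by lra.
Qed.

(** * The Levi-Civita product on the Lie algebra *)

Definition left_nabla u v : 'M[R]_n :=
  2^-1 *: (lie_bracket u v + lie_bracket u v^T + lie_bracket v u^T).

(** This is the Koszul formula without its derivative terms; the transposes in [left_nabla] arise
    when ad v and ad u are moved off [w] by adjunction. *)
Lemma frob_inner_left_nabla u v w :
  frob_inner (left_nabla u v) w = 2^-1 * (frob_inner (lie_bracket u v) w
    - frob_inner (lie_bracket v w) u - frob_inner (lie_bracket u w) v).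
Proof.
have E x y z : frob_inner (2^-1 *: (x + y + z)) w =
    2^-1 * (frob_inner x w + frob_inner y w + frob_inner z w).
  by rewrite frob_innerZl !frob_innerDl.
rewrite /left_nabla E [frob_inner (lie_bracket v w) u]frob_inner_bracket.
rewrite [frob_inner (lie_bracket u w) v]frob_inner_bracket.
rewrite [lie_bracket v^T u]lie_bracketC [lie_bracket u^T v]lie_bracketC.
by rewrite !frob_innerNr !opprK ![frob_inner w _]frob_innerC.
Qed.

(** The right-hand side of the Koszul formula changes sign when [v] and [w] are exchanged. *)
Lemma left_nabla_skew u v w :
  frob_inner (left_nabla u v) w = - frob_inner v (left_nabla u w).
Proof.
rewrite [in RHS]frob_innerC !frob_inner_left_nabla.
rewrite [lie_bracket w v]lie_bracketC frob_innerNl; ring.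
Qed.

Lemma left_nabla_torsion u v :
  left_nabla u v - left_nabla v u = lie_bracket u v.
Proof.
rewrite /left_nabla [lie_bracket v u]lie_bracketC.
by apply/matrixP => i j; rewrite !mxE; lra.
Qed.

(** * Symmetric and skew parts, and the curvature computation *)

Lemma sym_part_tr u : (sym_part u)^T = sym_part u.
Proof. by rewrite /sym_part linearZ linearD /= trmxK addrC. Qed.

Lemma skew_part_tr u : (skew_part u)^T = - skew_part u.
Proof. by rewrite /skew_part linearZ linearB /= trmxK -scalerN opprB. Qed.

Lemma sym_skew_part u : sym_part u + skew_part u = u.
Proof. by apply/matrixP => i j; rewrite !mxE; lra. Qed.

Lemma left_nabla_curvature u v :
  let u1 := sym_part u in let u2 := skew_part u in
  let v1 := sym_part v in let v2 := skew_part v in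
  frob_inner (left_nabla u (left_nabla v v) - left_nabla v (left_nabla u v)
              - left_nabla (lie_bracket u v) v) u
  = - 2 * frob_norm (lie_bracket u1 v1) ^+ 2
    + 4^-1 * frob_norm (lie_bracket u v) ^+ 2
    + 2 * frob_inner (lie_bracket u1 v1) (lie_bracket u2 v2).
Proof.
set S := sym_part u; set A := skew_part u.
set T := sym_part v; set B := skew_part v => /=.
have [ST AT] : S^T = S /\ A^T = - A by rewrite sym_part_tr skew_part_tr.
have [TT BT] : T^T = T /\ B^T = - B by rewrite sym_part_tr skew_part_tr.
rewrite -[u](sym_skew_part u) -[v](sym_skew_part v) -/S -/A -/T -/B.
move: S A T B ST AT TT BT => S A T B ST AT TT BT {u v}.
(* Here [a] and [b] are skew, [c] and [d] symmetric; [x] and [y] are half of nabla_u u and half of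
   nabla_v v. *)
pose a := lie_bracket S T; pose b := lie_bracket A B.
pose c := lie_bracket A T; pose d := lie_bracket B S.
pose x := lie_bracket A S; pose y := lie_bracket B T.
have uT : (S + A)^T = S - A by rewrite linearD /= ST AT.
have vT : (T + B)^T = T - B by rewrite linearD /= TT BT.
have uvE : lie_bracket (S + A) (T + B) = a + b + (c - d).
  rewrite !(lie_bracketDl, lie_bracketDr) [lie_bracket S B]lie_bracketC.
  by rewrite -/a -/b -/c -/d; apply/matrixP => i j; rewrite !mxE; lra.
have nuu : left_nabla (S + A) (S + A) = 2 *: x.
  rewrite /left_nabla uT !(lie_bracketDl, lie_bracketDr).
  rewrite !lie_bracketNr !lie_bracketxx [lie_bracket S A]lie_bracketC -/x.
  by apply/matrixP => i j; rewrite !mxE; lra.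
have nvv : left_nabla (T + B) (T + B) = 2 *: y.
  rewrite /left_nabla vT !(lie_bracketDl, lie_bracketDr).
  rewrite !lie_bracketNr !lie_bracketxx [lie_bracket T B]lie_bracketC -/y.
  by apply/matrixP => i j; rewrite !mxE; lra.
have nuv : left_nabla (S + A) (T + B) = 2^-1 *: (a + b + 3 *: c + d).
  rewrite /left_nabla uT vT !(lie_bracketDl, lie_bracketDr).
  rewrite !lie_bracketNr [lie_bracket T S]lie_bracketC.
  rewrite [lie_bracket T A]lie_bracketC.
  rewrite [lie_bracket S B]lie_bracketC [lie_bracket B A]lie_bracketC.
  by rewrite -/a -/b -/c -/d; apply/matrixP => i j; rewrite !mxE; lra.
(* Vanishing torsion gives this from [nuv] and [uvE]. *)
have nvu : left_nabla (T + B) (S + A) = 2^-1 *: (- a - b + 3 *: d + c).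
  rewrite -[LHS](subKr (left_nabla (S + A) (T + B))) left_nabla_torsion nuv uvE.
  by apply/matrixP => i j; rewrite !mxE; lra.
have aT : a^T = - a by rewrite lie_bracket_tr ST TT -lie_bracketC.
have bT : b^T = - b.
  rewrite lie_bracket_tr AT BT lie_bracketNl lie_bracketNr opprK.
  exact: lie_bracketC.
have cT : c^T = c by rewrite lie_bracket_tr AT TT lie_bracketNr -lie_bracketC.
have dT : d^T = d by rewrite lie_bracket_tr ST BT lie_bracketNr -lie_bracketC.
(* Adjunction turns all three products into products with [A]; their other factors are then related
   by the Jacobi identity for [T, [B, S]]. *)
have jacobi : frob_inner c d = frob_inner a b + frob_inner x y.
  rewrite [frob_inner a b]frob_innerC /c /x /b ![lie_bracket A _]lie_bracketC.
  rewrite !frob_innerNl !frob_inner_bracket ST TT BT lie_bracketNl.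
  rewrite /d lie_bracket_jacobi [lie_bracket T S]lie_bracketC -/a.
  rewrite [lie_bracket T B]lie_bracketC -/y !lie_bracketNl lie_bracketNr.
  rewrite [lie_bracket y S]lie_bracketC; clearbody a y.
  by rewrite frob_innerDr !frob_innerNr !opprK opprD opprK addrC.
(* In the Koszul formula with w = [u, v], the middle term gives |w|^2 / 2. The outer two give <w,
   [u^T, v] - [v^T, u]> / 2, where c + d cancels and a - b remains. *)
have nwv : frob_inner (left_nabla (a + b + (c - d)) (T + B)) (S + A)
    = 2^-1 * frob_inner (a + b + (c - d)) (a + b + (c - d))
      + frob_inner (a + b + (c - d)) (a - b).
  rewrite frob_inner_left_nabla [lie_bracket (T + B) (S + A)]lie_bracketC uvE.
  move: (a + b + (c - d)) => w.
  rewrite [lie_bracket w (T + B)]lie_bracketC.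
  rewrite [lie_bracket w (S + A)]lie_bracketC.
  rewrite !frob_innerNl !(frob_inner_bracket _ w) uT vT.
  have -> : lie_bracket (T - B) (S + A) = - (a - b + (c + d)).
    rewrite !(lie_bracketDl, lie_bracketDr) !lie_bracketNl -/d.
    rewrite [lie_bracket T S]lie_bracketC [lie_bracket T A]lie_bracketC.
    rewrite [lie_bracket B A]lie_bracketC.
    by rewrite -/a -/b -/c; apply/matrixP => i j; rewrite !mxE; lra.
  have -> : lie_bracket (S - A) (T + B) = a - b - (c + d).
    rewrite !(lie_bracketDl, lie_bracketDr) !lie_bracketNl.
    rewrite [lie_bracket S B]lie_bracketC -/d.
    by rewrite -/a -/b -/c; apply/matrixP => i j; rewrite !mxE; lra.
  clearbody a b c d.
  by rewrite !frob_innerE; lra.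
rewrite 2!frob_norm_sqr.
have E x1 x2 x3 z : frob_inner (x1 - x2 - x3) z
    = frob_inner x1 z - frob_inner x2 z - frob_inner x3 z.
  by rewrite !frob_innerE.
rewrite E uvE nwv nvv nuv left_nabla_skew nuu left_nabla_skew nvu.
have ca := frob_inner_sym_skew cT aT; have cb := frob_inner_sym_skew cT bT.
have da := frob_inner_sym_skew dT aT; have db := frob_inner_sym_skew dT bT.
rewrite -/a -/b [frob_inner (2 *: y) _]frob_innerC.
clearbody a b c d x y.
rewrite !frob_innerE.
rewrite ![frob_inner _ c]frob_innerC ![frob_inner _ d]frob_innerC.
rewrite ca cb da db [frob_inner b a]frob_innerC [frob_inner d c]frob_innerC.
(* With the skew-symmetric cross terms gone, the two sides differ by 4 (<c, d> - <x, y> - <a,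
   b>). *)
rewrite jacobi; lra.
Qed.

End FrobeniusInner.

(** * Smoothness of linear maps and openness of GL *)

Lemma smooth_cst (R : realType) (V W : normedModType R) (U : set V) (w : W) :
  smooth U (cst w : V -> W).
Proof.
move=> k; elim: k w => [|k IH] w /=; first by move=> p _; exact: cst_continuous.
split=> [p _|v]; first exact: differentiable_cst.
rewrite [X in Ck _ _ X](_ : _ = cst 0); first exact: IH.
by apply/funext => p; exact: derive_cst.
Qed.

Lemma derive_linear (R : realType) (V W : normedModType R)
    (f : {linear V -> W}) (p v : V) : continuous f -> 'D_v f p = f v.
Proof.
by move=> cf; rewrite deriveE ?diff_lin //; exact: linear_differentiable.
Qed.

(** Each directional derivative is a constant map, which reduces the claim to [smooth_cst]. *)
Lemma smooth_linear (R : realType) (V W : normedModType R) (U : set V)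
  (f : {linear V -> W}) : continuous f -> smooth U f.
Proof.
move=> cf [|k] /=; first by move=> p _; exact: cf.
split=> [p _|v]; first exact: linear_differentiable.
rewrite [X in Ck _ _ X](_ : _ = cst (f v)); first exact: smooth_cst.
by apply/funext => p; exact: derive_linear.
Qed.

Lemma continuous_mx (R : realType) (T : topologicalType) m n
    (f : T -> 'M[R]_(m, n)) :
  (forall i j, continuous (fun t => f t i j)) -> continuous f.
Proof.
move=> cf t A [P Pnbhs PA].
have : \forall s \near t, forall ij : 'I_m * 'I_n, P ij.1 ij.2 (f s ij.1 ij.2).
  by apply: filter_forall => -[i j]; apply: cf; exact: Pnbhs.
by apply: filterS => s H; apply: PA => i j; exact: (H (i, j)).
Qed.

Lemma continuous_mulmxr (R : realType) m n q (u : 'M[R]_(n, q)) :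
  continuous (fun p : 'M[R]_(m, n) => p *m u).
Proof.
apply: continuous_mx => i j.
under [X in continuous X]eq_fun do rewrite mxE.
apply: continuous_big => [|k _]; first exact: add_continuous.
move=> p; apply: (cvgM (F := nbhs p)); last exact: cvg_cst.
exact: coord_continuous.
Qed.

Lemma continuous_det (R : realType) n : continuous (@determinant R n).
Proof.
apply: continuous_big => [|s _]; first exact: add_continuous.
move=> p; apply: (cvgM (F := nbhs p)); first exact: cvg_cst.
move: p.
apply: continuous_big => [|i _]; first exact: mul_continuous.
exact: coord_continuous.
Qed.

Lemma open_GL (R : realType) n : open (GL R n).
Proof.
have -> : GL R n = determinant @^-1` [set x | x != 0].
  by apply/funext => p; apply/propext; rewrite /GL /= unitmxE unitfE.
apply: open_comp => [p _|]; [exact: continuous_det|exact: open_neq].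
Qed.

(** * Connection and curvature on left invariant fields *)

Section LeftInvariantFields.
Context {R : realType} {n : nat}.
Implicit Types u v w p : 'M[R]_n.

Lemma derive_left_field u p v : 'D_v (left_field u) p = v *m u.
Proof.
exact: (@derive_linear _ _ _ (mulmxr u)) (@continuous_mulmxr _ _ _ _ u).
Qed.

Lemma smooth_left_field u : smooth (GL R n) (left_field u).
Proof.
exact: (@smooth_linear _ _ _ _ (mulmxr u)) (@continuous_mulmxr _ _ _ _ u).
Qed.

Lemma field_bracket_left_field u v :
  field_bracket (left_field u) (left_field v) = left_field (lie_bracket u v).
Proof.
apply/funext => p; rewrite /field_bracket !derive_left_field.
by rewrite /left_field /lie_bracket mulmxBr !mulmxA.
Qed.

Lemma left_metric_left_field p u x : GL R n p ->
  left_metric p x (left_field u p) = frob_inner (invmx p *m x) u.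
Proof. by move=> Gp; rewrite /left_metric /left_field mulKmx. Qed.

Lemma left_metric_left_fields p u v : GL R n p ->
  left_metric p (left_field u p) (left_field v p) = frob_inner u v.
Proof. by move=> Gp; rewrite left_metric_left_field // /left_field mulKmx. Qed.

Lemma derive_left_metric u v w p : GL R n p ->
  field_deriv (left_field w)
    (fun q => left_metric q (left_field u q) (left_field v q)) p = 0.
Proof.
move=> Gp; rewrite /field_deriv.
rewrite -(derive_cst (frob_inner u v) p (left_field w p)).
(* The inner product is known to be constant only on GL, since [invmx] returns a singular matrix
   unchanged; openness of GL makes this enough for the derivative at [p]. *)
apply: near_eq_derive; apply: filterS (open_nbhs_nbhs (conj (@open_GL R n) Gp)).
by move=> q Gq; exact: left_metric_left_fields.
Qed.

Context {nabla : ('M[R]_n -> 'M[R]_n) -> ('M[R]_n -> 'M[R]_n) ->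
  'M[R]_n -> 'M[R]_n}.
Context (nablaLC : levi_civita (GL R n) left_metric nabla).

Lemma levi_civita_left_field u v p : GL R n p ->
  nabla (left_field u) (left_field v) p = left_field (left_nabla u v) p.
Proof.
move=> Gp; have [_ torsion metric] := nablaLC.
have pU : p \in GL R n by rewrite inE.
pose N x y := invmx p *m nabla (left_field x) (left_field y) p.
have NB x y : N x y - N y x = lie_bracket x y.
  rewrite /N -mulmxBr torsion //; [|exact: smooth_left_field..].
  by rewrite field_bracket_left_field /left_field mulKmx.
have NM x y z : frob_inner (N z x) y + frob_inner (N z y) x = 0.
  rewrite -(derive_left_metric x y z Gp) metric //; [|exact: smooth_left_field..].
  rewrite left_metric_left_field // /left_metric /left_field mulKmx //.
  by rewrite [frob_inner x _]frob_innerC.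
suff <- : N u v = left_nabla u v by rewrite /left_field mulKVmx.
apply: frob_inner_inj => w; rewrite frob_inner_left_nabla.
rewrite -!NB.
have BE x y z : frob_inner (x - y) z = frob_inner x z - frob_inner y z.
  by rewrite frob_innerDl frob_innerNl.
rewrite !BE.
(* Koszul's argument: once brackets are replaced by differences of [N], the three metric identities
   leave twice <N u v, w>. *)
by have [[]] := (NM v w u, NM u v w, NM u w v); lra.
Qed.

Lemma curvature_left_field u v p : GL R n p ->
  curvature nabla (left_field u) (left_field v) (left_field v) p =
  left_field (left_nabla u (left_nabla v v) - left_nabla v (left_nabla u v)
              - left_nabla (lie_bracket u v) v) p.
Proof.
move=> Gp; have [[loc smth _ _ _ _] _ _] := nablaLC.
have pU : p \in GL R n by rewrite inE.
have nn x y z : nabla (left_field x) (nabla (left_field y) (left_field z)) p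
    = left_field (left_nabla x (left_nabla y z)) p.
  (* The inner covariant derivative is left invariant only on GL, so locality of the connection is
     what allows replacing it under the outer one. *)
  rewrite -levi_civita_left_field //; apply: loc => //.
  1,2,4: exact: smooth_left_field.
    by apply: smth; exact: smooth_left_field.
  by move=> q; rewrite inE => Gq; exact: levi_civita_left_field.
rewrite /curvature !nn field_bracket_left_field levi_civita_left_field //.
by rewrite /left_field !mulmxBr.
Qed.

End LeftInvariantFields.

Theorem theorem2p6 (R : realType) (n : nat) (n_ge1 : (1 <= n)%N)
    (nabla : ('M[R]_n -> 'M[R]_n) -> ('M[R]_n -> 'M[R]_n) -> 'M[R]_n -> 'M[R]_n)
    (nablaLC : levi_civita (GL R n) left_metric nabla)
    (u v : 'M[R]_n) (p : 'M[R]_n) (Gp : GL R n p) :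
  let u1 := sym_part u in let u2 := skew_part u in
  let v1 := sym_part v in let v2 := skew_part v in
  left_metric p
    (curvature nabla (left_field u) (left_field v) (left_field v) p)
    (left_field u p)
  = - 2 * frob_norm (lie_bracket u1 v1) ^+ 2
    + 4^-1 * frob_norm (lie_bracket u v) ^+ 2
    + 2 * frob_inner (lie_bracket u1 v1) (lie_bracket u2 v2).
Proof.
rewrite (curvature_left_field nablaLC) // left_metric_left_fields //.
exact: left_nabla_curvature.
Qed.
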